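(* Let $F$ be a Markov chain on a measurable space $S$ and let $A,B\subseteq S$ be measurable. There exists a generalised Streett supermartingale for $(F,(A,B))$ if and only if $\mathbb{E}_{s_0}[\mathrm{step}^{(A,B)}_{s_0}] < \infty$ for every $s_0 \in S$.
   Context: A Markov chain on a measurable space $S$ is a Markov kernel $F$ from $S$ to $S$; write $F_s$ for $F(s,\cdot)$; the next-time operator maps measurable $g:S\to[0,\infty]$ to $(\mathbb{X}g)(s) = \int g\,dF_s$. A generalised Streett supermartingale (GSSM) for $(F,(A,B))$ is a measurable function $r : S \to [0,\infty)$ (finite-valued) such that $(\mathbb{X}r)(x) \le r(x) - \chi_{A\setminus B}(x)$ for every $x \notin B$, where $\chi_{A\setminus B}$ is the indicator of $A\setminus B$. For $s_0 \in S$, $\mathbb{P}_{s_0}$ is the unique probability measure on $S^\omega$ (cylinder $\sigma$-algebra) of trajectories $s_1 s_2 \dots$ such that for every measurable $g : S^n \to [0,\infty]$, $\int g(s_1,\dots,s_n)\,d\mathbb{P}_{s_0} = \int\cdots\int g\,dF_{s_{n-1}}(s_n)\cdots dF_{s_0}(s_1)$; $\mathbb{E}_{s_0}$ is its expectation. $\mathrm{step}^{(A,B)}_{s_0}(s_1 s_2\cdots) = |\{ i \mid 0 \le i < \min\{ j \ge 0 \mid s_j \in B\},\ s_i \in A\}|$ (minimum of the empty set being $\infty$). *)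

(* Defs.v *)
From HB Require Import structures.
From mathcomp Require Import all_boot all_order all_algebra.
From mathcomp Require Import all_classical all_reals all_analysis.
From mathcomp Require Import measurable_realfun.
Set Implicit Arguments.
Unset Strict Implicit.
Unset Printing Implicit Defensive.
Import Order.TTheory GRing.Theory Num.Theory.
Import numFieldNormedType.Exports.
Local Open Scope classical_set_scope.
Local Open Scope ring_scope.
Local Open Scope ereal_scope.

Definition cylinders (d : measure_display) (S : measurableType d) :
    set (set (nat -> S)) :=
  \bigcup_n preimage_set_system setT (fun w : nat -> S => w n) measurable.
Arguments cylinders {d} S.

(* A trajectory s_1 s_2 ... starts after the initial state, so w : trajectory S
   encodes it with the shift w i = s_{i+1}. *)
Definition trajectory (d : measure_display) (S : measurableType d) :=
  g_sigma_algebraType (cylinders S).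
Arguments trajectory {d} S.

(* state s0 w i is s_i: the initial state for i = 0, read off w otherwise. *)
Definition state (d : measure_display) (S : measurableType d)
    (s0 : S) (w : trajectory S) (i : nat) : S :=
  if i is k.+1 then w k else s0.

Definition next_time (d : measure_display) (S : measurableType d)
    (R : realType) (F : R.-pker S ~> S) (g : S -> \bar R) (s : S) : \bar R :=
  \int[F s]_x g x.

Definition is_GSSM (d : measure_display) (S : measurableType d)
    (R : realType) (F : R.-pker S ~> S) (A B : set S) (r : S -> R) : Prop :=
  [/\ measurable_fun [set: S] r,
      forall x, (0 <= r x)%R
    & forall x, ~ B x ->
        next_time F (fun y => (r y)%:E) x <=
        (r x)%:E - (\1_(A `\` B) x : R)%:E].

(* \int ... \int g(s_1, ..., s_n) dF_{s_{n-1}}(s_n) ... dF_{s}(s_1); the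
   outermost integral is the one in s_1. *)
Fixpoint iterated_integral (d : measure_display) (S : measurableType d)
    (R : realType) (F : R.-pker S ~> S) (n : nat) :
    S -> (n.-tuple S -> \bar R) -> \bar R :=
  if n is m.+1 then
    fun s g => \int[F s]_x
      iterated_integral F x (fun t : m.-tuple S => g [tuple of x :: t])
  else fun _ g => g [tuple].

Definition is_trajectory_law (d : measure_display) (S : measurableType d)
    (R : realType) (F : R.-pker S ~> S) (s0 : S)
    (P : probability (trajectory S) R) : Prop :=
  forall (n : nat) (g : n.-tuple S -> \bar R),
    measurable_fun [set: n.-tuple S] g -> (forall t, 0 <= g t) ->
    \int[P]_w g [tuple w (nat_of_ord i) | i < n] = iterated_integral F s0 g.

(* min {j >= 0 | s_j \in B}, equal to +oo when B is never visited. *)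
Definition hitting_time (d : measure_display) (S : measurableType d)
    (R : realType) (B : set S) (s0 : S) (w : trajectory S) : \bar R :=
  ereal_inf [set j%:R%:E | j in [set j : nat | B (state s0 w j)]].

Definition step (d : measure_display) (S : measurableType d)
    (R : realType) (A B : set S) (s0 : S) (w : trajectory S) : \bar R :=
  counting [set i : nat | i%:R%:E < hitting_time R B s0 w /\ A (state s0 w i)].
Arguments step {d S} R A B s0 w.

(* Main.v *)
(* Let v_i(s) be the probability, from s, that s_i is in A and none of s_0, ..., s_i
   is in B. The step count is the sum over i of the indicators of these events,
   so E_s[step] = sum_i v_i(s). By the Markov property, outside B the tail sum_i v_{i+1}
   is the next-time operator applied to sum_i v_i; hence sum_i v_i is a supermartingale
   with equality, as soon as it is finite. Conversely every supermartingale
   dominates each partial sum sum_{i<n} v_i, by induction on n. *)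
Require Import Defs.
From mathcomp Require Import all_boot all_order all_algebra.
From mathcomp Require Import all_classical all_reals all_analysis.
From mathcomp Require Import measurable_realfun.
Import Order.TTheory GRing.Theory Num.Theory.
Local Open Scope classical_set_scope.
Local Open Scope ring_scope.
Local Open Scope ereal_scope.


Set Implicit Arguments.
Unset Strict Implicit.
Unset Printing Implicit Defensive.

Section counted_visits.
Context (S : Type) (A B : set S).
Implicit Types q : nat -> S.

(** Stated for bare sequences, so that it serves both infinite trajectories and finite prefixes
    padded by [nth]. *)
Definition counted q (i : nat) : Prop :=
  (forall j, (j <= i)%N -> ~ B (q j)) /\ A (q i).

Lemma counted0 q : counted q 0 = (A `\` B) (q 0%N).
Proof.
rewrite propeqE; split=> [[nB a]|[a nB]]; split=> //; first exact: nB.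
by move=> j; rewrite leqn0 => /eqP ->.
Qed.

Lemma countedS q i : counted q i.+1 = (~ B (q 0%N) /\ counted (q \o succn) i).
Proof.
rewrite propeqE; split=> [[nB a]|[nB0 [nB a]]].
  by split; [exact: nB|split=> // j ji; exact: nB].
by split=> // -[|j] //; exact: nB.
Qed.

Lemma eq_counted q q' i :
  (forall j, (j <= i)%N -> q j = q' j) -> counted q i = counted q' i.
Proof.
move=> qq'; rewrite /counted qq'// propeqE.
by split=> -[nB a]; split=> // j ji; [rewrite -qq'//|rewrite qq'//]; exact: nB.
Qed.

End counted_visits.

Section streett.
Context (d : measure_display) (S : measurableType d) (R : realType).
Context (F : R.-pker S ~> S) (A B : set S).
Hypotheses (mA : measurable A) (mB : measurable B).

(** If [B] is avoided up to time [i], every hitting index is at least [i.+1], hence so is the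
    infimum; this includes the case of no visit, where it is [+oo]. *)
Lemma lt_hitting_time (s0 : S) (w : trajectory S) (i : nat) :
  (i%:R%:E < hitting_time R B s0 w)
  <-> (forall j, (j <= i)%N -> ~ B (state s0 w j)).
Proof.
split=> [ih j ji Bj|nB].
  have := lt_le_trans ih (ereal_inf_lbound (imageP _ Bj)).
  by rewrite lte_fin ltr_nat ltnNge ji.
apply: (@lt_le_trans _ _ i.+1%:R%:E); first by rewrite lte_fin ltr_nat.
apply/ereal_infP => _ [j Bj <-]; rewrite lee_fin ler_nat ltnNge.
by apply/negP => /nB.
Qed.

(** An event on tuples, because a trajectory law is tested on functions of finite prefixes. The
    tuple holds s_1, ..., s_i, so [s0] is prepended; indices up to [i] then never reach the default
    of [nth]. *)
Definition visit_event (s0 : S) (i : nat) : set (i.-tuple S) :=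
  [set t | counted A B (nth s0 (s0 :: t)) i].
Arguments visit_event : clear implicits.

Definition prefix_tuple (i : nat) (w : trajectory S) : i.-tuple S :=
  [tuple w (nat_of_ord k) | k < i].

Lemma step_series (s0 : S) (w : trajectory S) :
  step R A B s0 w =
  \sum_(0 <= i <oo) (\1_(visit_event s0 i) (prefix_tuple i w) : R)%:E.
Proof.
rewrite /step counting_dirac; apply: eq_eseriesr => i _.
rewrite diracE indicE; congr (_%:R%:E); congr nat_of_bool.
apply/idP/idP; rewrite !inE /visit_event /=.
all: rewrite -(@eq_counted _ A B (state s0 w)); last first.
(* Trajectory and padded prefix agree up to index [i], and [counted] looks no further. *)
1,3: move=> [|j] //= ji; rewrite -(tnth_nth _ (prefix_tuple i w) (Ordinal ji)).
1,2: by rewrite tnth_mktuple.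
- by move=> [/lt_hitting_time].
- by move=> [? ?]; split=> //; apply/lt_hitting_time.
Qed.

Lemma measurable_visit_event (s0 : S) (i : nat) :
  measurable (visit_event s0 i).
Proof.
have mnth j (C : set S) : (j <= i)%N -> measurable C ->
    measurable [set t : i.-tuple S | C (nth s0 (s0 :: t) j)].
  move=> ji mC; rewrite -[X in measurable X]setTI.
  suff: measurable_fun setT (fun t : i.-tuple S => nth s0 (s0 :: t) j) by exact.
  case: j ji => [|j] ji; first exact: measurable_cst.
  rewrite (_ : (fun _ => _) = (@tnth i S ^~ (Ordinal ji))).
    exact: measurable_tnth.
  by apply/funext => t; rewrite (tnth_nth s0).
rewrite (_ : visit_event s0 i =
  \bigcap_(j in `I_i.+1) [set t : i.-tuple S | (~` B) (nth s0 (s0 :: t) j)]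
  `&` [set t : i.-tuple S | A (nth s0 (s0 :: t) i)])//.
apply: measurableI; last exact: mnth.
apply: fin_bigcap_measurable; first exact: finite_II.
by move=> j ji; apply: mnth => //; exact: measurableC.
Qed.

Lemma measurable_prefix_tuple (i : nat) :
  measurable_fun setT (prefix_tuple i).
Proof.
apply/measurable_fun_tnthP => k.
rewrite (_ : _ \o _ = fun w : trajectory S => w k); last first.
  by apply/funext => w /=; rewrite tnth_mktuple.
move=> _ C mC; apply: sub_sigma_algebra; exists (nat_of_ord k) => //.
by exists C.
Qed.

(** The v_i(s), built from the kernel alone by conditioning on the first step; measurability in [s]
    then follows by induction. *)
Fixpoint visit_prob (i : nat) : S -> \bar R :=
  if i is k.+1 then
    fun s => (\1_(~` B) s : R)%:E * next_time F (visit_prob k) s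
  else fun s => (\1_(A `\` B) s : R)%:E.

Lemma visit_prob_ge0 i s : 0 <= visit_prob i s.
Proof.
elim: i s => [|i IH] s /=; first by rewrite lee_fin.
by rewrite mule_ge0 ?lee_fin// integral_ge0.
Qed.

Lemma measurable_visit_prob i : measurable_fun setT (visit_prob i).
Proof.
elim: i => [|i IH] /=.
  by apply/measurable_EFinP/measurable_indic/measurableD.
apply: emeasurable_funM.
  by apply/measurable_EFinP/measurable_indic/measurableC.
apply: measurable_fun_integral_kernel => //; last exact: visit_prob_ge0.
exact: measurable_kernel.
Qed.

Lemma iterated_integral0 n (s : S) :
  iterated_integral F s (fun _ : n.-tuple S => 0) = 0.
Proof.
elim: n s => [|n IH] s //=.
by under eq_integral do rewrite IH; rewrite integral0.
Qed.

Lemma iterated_integral_visit_event i s :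
  iterated_integral F s (fun t => (\1_(visit_event s i) t : R)%:E) =
  visit_prob i s.
Proof.
elim: i s => [|i IH] s /=.
  rewrite !indicE; congr (_%:R%:E); congr nat_of_bool.
  by apply/idP/idP; rewrite !inE /visit_event /= counted0.
have visitE x (t : i.-tuple S) : visit_event s i.+1 [tuple of x :: t] =
    ((~` B) s /\ visit_event x i t).
  rewrite /visit_event /= countedS; congr (_ /\ _); apply: eq_counted => j ji.
  (* The two sides differ only in the default of [nth], and [j] is within bounds. *)
  by apply: set_nth_default; rewrite /= size_tuple.
have visitS x (t : i.-tuple S) :
    \1_(visit_event s i.+1) [tuple of x :: t] =
    (\1_(~` B) s * \1_(visit_event x i) t)%R :> R.
  rewrite !indicE -natrM mulnb; congr (nat_of_bool _)%:R.
  by rewrite -[RHS]asbool_and -visitE.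
(* The factor depending on [s] is now 0 or 1: the integrand vanishes or is that of the induction
   hypothesis. *)
have [Bs|nBs] := pselect (B s).
  rewrite indicE memNset// mul0e (eq_integral (cst 0)) ?integral0// => x _.
  under eq_fun do rewrite visitS indicE memNset// mul0r.
  exact: iterated_integral0.
rewrite indicE mem_set// mul1e; apply: eq_integral => x _.
by under eq_fun do rewrite visitS indicE mem_set// mul1r.
Qed.

(** Nonnegativity lets sum and integral be exchanged; each term depends on a finite prefix, so the
    law evaluates it as an iterated integral. *)
Lemma expected_step (s0 : S) (P : probability (trajectory S) R) :
  is_trajectory_law F s0 P ->
  \int[P]_w step R A B s0 w = \sum_(0 <= i <oo) visit_prob i s0.
Proof.
move=> hP; under eq_integral do rewrite step_series.
have mvisit i : measurable_fun setT
    (fun t : i.-tuple S => (\1_(visit_event s0 i) t : R)%:E).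
  by apply/measurable_EFinP/measurable_indic; exact: measurable_visit_event.
rewrite integral_nneseries//; last first.
  by move=> i; exact: measurableT_comp (mvisit i) (@measurable_prefix_tuple i).
apply: eq_eseriesr => i _; rewrite -iterated_integral_visit_event.
by apply: (hP i) => // t; rewrite lee_fin.
Qed.

Lemma GSSM_ge_sum_visit_prob (r : S -> R) : is_GSSM F A B r ->
  forall n s, \sum_(0 <= i < n) visit_prob i s <= (r s)%:E.
Proof.
move=> [mr r0 rF]; elim=> [|n IH] s; first by rewrite big_nil lee_fin.
rewrite big_nat_recl//=.
(* On [B] all terms vanish and [r] is nonnegative; off [B] the terms after the first are next-time
   values. *)
have [Bs|nBs] := pselect (B s).
  rewrite big1 ?adde0 => [|i _]; last by rewrite indicE memNset// mul0e.
  by rewrite indicE memNset ?lee_fin// => -[].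
under eq_bigr do rewrite indicE mem_set// mul1e.
(* With the finite first term moved to the right, the supermartingale inequality reduces the goal to
   monotonicity of the integral, fed by the induction hypothesis at every successor. *)
rewrite addeC -leeBrDr//; apply: le_trans (rF s nBs).
rewrite -ge0_integral_sum//; last 2 first.
- by move=> i; exact: measurable_visit_prob.
- by move=> *; exact: visit_prob_ge0.
apply: ge0_le_integral => //.
- by move=> x _; apply: sume_ge0 => *; exact: visit_prob_ge0.
- by apply: emeasurable_sum => i; exact: measurable_visit_prob.
- exact/measurable_EFinP.
Qed.

Lemma fine_series_visit_prob_GSSM :
  (forall s, \sum_(0 <= i <oo) visit_prob i s < +oo) ->
  is_GSSM F A B (fun s => fine (\sum_(0 <= i <oo) visit_prob i s)).
Proof.
move=> fin.
have ge0 s : 0 <= \sum_(0 <= i <oo) visit_prob i s.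
  by apply: nneseries_ge0 => *; exact: visit_prob_ge0.
have fineE s : (fine (\sum_(0 <= i <oo) visit_prob i s))%:E =
    \sum_(0 <= i <oo) visit_prob i s.
  by rewrite fineK// ge0_fin_numE.
split=> [|s|s nBs]; last 2 first.
- exact: fine_ge0.
- rewrite /next_time; under eq_integral do rewrite fineE.
  rewrite integral_nneseries//; last 2 first.
  + by move=> i; exact: measurable_visit_prob.
  + by move=> *; exact: visit_prob_ge0.
  (* The head of the series is the indicator of [A] minus [B], which cancels; the shifted tail
     matches the next-time side term by term. *)
  rewrite fineE nneseries_recl//; last by move=> *; exact: visit_prob_ge0.
  rewrite addeAC subee// add0e -nneseries_addn; last first.
    by move=> *; exact: visit_prob_ge0.
  rewrite le_eqVlt; apply/predU1P; left; apply: eq_eseriesr => i _.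
  by rewrite addn1 /= indicE mem_set// mul1e.
- apply/measurable_EFinP; rewrite /comp; under eq_fun do rewrite fineE.
  apply: ge0_emeasurable_sum => i *; first exact: visit_prob_ge0.
  exact: measurable_visit_prob.
Qed.

End streett.

Theorem theorem3p6 (d : measure_display) (S : measurableType d) (R : realType)
    (F : R.-pker S ~> S)
    (P : S -> probability (trajectory S) R)
    (hP : forall s0 : S, is_trajectory_law F s0 (P s0))
    (A B : set S) (mA : measurable A) (mB : measurable B) :
  (exists r : S -> R, is_GSSM F A B r) <->
  (forall s0 : S, \int[P s0]_w step R A B s0 w < +oo).
Proof.
have expE s := expected_step mA mB (hP s).
split=> [[r rG] s|fin].
  (* The real number [r s] bounds all partial sums, hence their limit. *)
  rewrite expE; apply: le_lt_trans (ltry (r s)); apply: lime_le.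
    by apply: is_cvg_nneseries => *; exact: visit_prob_ge0.
  by apply: nearW => n; exact: GSSM_ge_sum_visit_prob.
exists (fun s => fine (\sum_(0 <= i <oo) visit_prob F A B i s)).
by apply: fine_series_visit_prob_GSSM => // s; rewrite -expE.
Qed.
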